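(* Let $\varepsilon > 0$ and let $\mathcal{C}:[0,1]\to M_n$ be a matrix path. Then there is a $\delta > 0$ such that for any matrix path $\mathcal{C}':[0,1]\to M_n$ with $\|\mathcal{C}_\alpha - \mathcal{C}'_\alpha\| < \delta$ for all $\alpha \in [0,1]$ and any $\mathcal{C}'$-eigenpath set $\{\gamma_1', \ldots, \gamma_n'\}$, there is a $\mathcal{C}$-eigenpath set $\{\gamma_1, \ldots, \gamma_n\}$ satisfying $|\gamma_j(\alpha) - \gamma_j'(\alpha)| < \varepsilon$ for all $\alpha \in [0,1]$ and all $j=1,\ldots,n$.
   Context: $M_n$ is the space of $n\times n$ complex matrices, with norm $\|A\|=\max_{i,j}|a_{i,j}|$. A matrix path is a continuous function $\mathcal{C}:[0,1]\to M_n$, with value $\mathcal{C}_\alpha$ at $\alpha$. $\Sigma(A)$ denotes the spectrum of $A\in M_n$ as a multiset of size $n$ (eigenvalues with algebraic multiplicity). A $\mathcal{C}$-eigenpath set is a multiset $\{\gamma_1,\ldots,\gamma_n\}$ of continuous functions $\gamma_j:[0,1]\to\mathbb{C}$ (possibly not all distinct) such that $\Sigma(\mathcal{C}_\alpha)=\{\gamma_1(\alpha),\ldots,\gamma_n(\alpha)\}$ as multisets for all $\alpha\in[0,1]$. *)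

(* Defs.v *)
From HB Require Import structures.
From mathcomp Require Import all_boot all_order all_algebra.
From mathcomp Require Import finmap multiset complex.
From mathcomp Require Import all_classical all_reals all_analysis.

Set Implicit Arguments.
Unset Strict Implicit.
Unset Printing Implicit Defensive.

Import Order.TTheory GRing.Theory Num.Theory.
Import numFieldNormedType.Exports.

Local Open Scope classical_set_scope.
Local Open Scope ring_scope.
Local Open Scope complex_scope.
Local Open Scope mset_scope.

(* The usual topology of the complex numbers: R[i] gets the topology and the
   normed module structure that its modulus induces, exactly as R[i]^o does.
   The matrix type 'M[R[i]]_n then inherits the norm max_(i, j) `|A i j|. As for
   any numeric field, norms take their values in the scalars, here R[i], in the
   nonnegative reals; they are compared with r : R through the embedding
   r%:C. *)
#[export, non_forgetful_inheritance]
HB.instance Definition _ (R : realType) :=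
  PseudoPointedMetric.copy R[i] (R[i]^o).
#[export, non_forgetful_inheritance]
HB.instance Definition _ (R : realType) := NormedModule.copy R[i] (R[i]^o).

(* The sequence is the one of the factors of the monic polynomial
   char_poly A = \prod_(z <- s) ('X - z%:P). *)
Definition spectrum (R : realType) (n : nat) (A : 'M[R[i]]_n) : {mset R[i]} :=
  seq_mset (sval (closed_field_poly_normal (char_poly A))).

Lemma spectrumE (R : realType) (n : nat) (A : 'M[R[i]]_n) (z : R[i]) :
  spectrum A z = mup z (char_poly A).
Proof.
rewrite /spectrum mset_seqE; case: closed_field_poly_normal => s /= Ds.
by rewrite [in RHS]Ds (monicP (char_poly_monic A)) scale1r mu_prod_XsubC.
Qed.

(* A path on the unit interval is a function on R of which only the restriction
   to [0, 1] matters; {within `[0, 1], continuous f} is continuity for the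
   subspace topology, hence one-sided at 0 and 1. *)
Definition matrix_path (R : realType) (n : nat) (C : R -> 'M[R[i]]_n) : Prop :=
  {within `[0, 1], continuous C}.

(* The multiset of n paths is indexed by 'I_n, repetitions being allowed. *)
Definition eigenpath_set (R : realType) (n : nat) (C : R -> 'M[R[i]]_n)
    (gamma : 'I_n -> R -> R[i]) : Prop :=
  (forall j : 'I_n, {within `[0, 1], continuous (gamma j)}) /\
  (forall a : R, a \in `[0, 1] ->
     spectrum (C a) = seq_mset [seq gamma j a | j <- enum 'I_n]).

(* Main.v *)
Require Import Defs.
From HB Require Import structures.
From mathcomp Require Import all_boot all_order all_algebra.
From mathcomp Require Import finmap multiset complex.
From mathcomp Require Import all_classical all_reals all_analysis.
From mathcomp Require Import ring.

Set Implicit Arguments.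
Unset Strict Implicit.
Unset Printing Implicit Defensive.

Import Order.TTheory GRing.Theory Num.Theory.
Import numFieldNormedType.Exports.

Local Open Scope ring_scope.
Local Open Scope complex_scope.

(* Suppose no delta works, and take matrix paths C'_k within 1/(k+1) of C with
   eigenpath sets gamma'_k far from every C-eigenpath set.  For k large and s
   near a, the eigenvalues of C'_k(s) lie in small disjoint discs around those of
   C(a), and a continuous path cannot jump from one disc to another: the paths
   gamma'_k are asymptotically equicontinuous at a.  The discs also show that
   gamma'_k(a) converges along any nonprincipal ultrafilter; as in the
   Arzela-Ascoli theorem the convergence is uniform on [0, 1] and the limit is
   continuous.  Passing to the limit in the characteristic polynomials, this
   limit is a C-eigenpath set, a contradiction. *)

(** * Perturbation of the roots of a polynomial *)

(** If a root [b] of [q] is [eta]-far from all roots of [p], then [|p(b)|] is at least of order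
    [(1 + |b|)^n], while [p(b) = (p - q)(b)] is at most [delta] times that order. The weight
    [1 + |b|] makes the estimate uniform in [b]. *)
Lemma root_near (K : numClosedFieldType) (p : {poly K}) (eta : K) :
  p \is monic -> 0 < eta ->
  exists2 delta : K, 0 < delta & forall q : {poly K}, (size q <= size p)%N ->
    (forall i, `|p`_i - q`_i| < delta) ->
    forall b, root q b -> exists2 a, root p a & `|b - a| < eta.
Proof.
move=> pmon eta0; have [s Ds] := closed_field_poly_normal p.
rewrite (monicP pmon) scale1r in Ds.
(* [L] is chosen so that [eta <= |b - z|] and [|z| <= M] give [1 + |b| <= |b - z| * L]. *)
pose M := \sum_(z <- s) `|z|; pose L := 1 + (1 + M) / eta; pose n := size s.
have M0 : 0 <= M by apply: sumr_ge0.
have M1 : 0 < 1 + M by rewrite ltr_wpDr.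
have L0 : 0 < L by rewrite addr_gt0 // divr_gt0.
have szp : size p = n.+1 by rewrite Ds size_prod_XsubC.
(* [p - q] has at most [n.+1] coefficients; the factor [n.+2] leaves the ratio [n.+1 / n.+2 < 1],
   hence a contradiction. *)
exists ((n.+2%:R * L ^+ n)^-1) => [|q szq pq b qb].
  by rewrite invr_gt0 mulr_gt0 ?ltr0n ?exprn_gt0.
apply: contrapT => far.
have {far}far z : z \in s -> 1 + `|b| <= `|b - z| * L.
  move=> zs; have zM : `|z| <= M.
    rewrite /M (big_rem z) //= lerDl; exact: sumr_ge0.
  have etaz : eta <= `|b - z|.
    rewrite real_leNgt ?normr_real ?gtr0_real//; apply/negP => bz.
    by apply: far; exists z => //; rewrite Ds root_prod_XsubC.
  have : `|b| <= `|b - z| + `|z| by rewrite -{1}(subrK z b) ler_normD.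
  move=> bz; rewrite mulrDr mulr1.
  apply: (@le_trans _ _ (1 + (`|b - z| + `|z|))); first by rewrite lerD2l.
  rewrite addrCA lerD2l (@le_trans _ _ (1 + M)) ?lerD2l // mulrCA ler_peMr //.
    exact: ltW.
  by rewrite ler_pdivlMr // mul1r.
have bn : (1 + `|b|) ^+ n <= `|p.[b]| * L ^+ n.
  rewrite Ds horner_prod normr_prod /n {n szp pq}.
  have prodE x : x ^+ size s = \prod_(z <- s) x.
    by rewrite big_const_seq count_predT iter_mulr_1.
  rewrite !prodE -big_split /=.
  rewrite !big_seq; apply: ler_prod => z zs.
  by rewrite hornerXsubC far // addr_ge0.
have b1 : 1 <= 1 + `|b| by rewrite lerDl.
have b0 : 0 < (1 + `|b|) ^+ n by rewrite exprn_gt0 // (lt_le_trans ltr01).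
have : `|p.[b]| <= n.+1%:R * (n.+2%:R * L ^+ n)^-1 * (1 + `|b|) ^+ n.
  have -> : p.[b] = (p - q).[b] by rewrite hornerD hornerN (rootP qb) subr0.
  rewrite (@horner_coef_wide _ n.+1); last first.
    by rewrite (leq_trans (size_polyD _ _)) // size_polyN geq_max -szp leqnn.
  apply: le_trans (ler_norm_sum _ _ _) _.
  rewrite -mulrA mulr_natl -[n.+1 in leRHS]card_ord -sumr_const.
  apply: ler_sum => i _; rewrite normrM normrX coefB ler_pM //.
    by rewrite card_ord; exact/ltW/pq.
  apply: (@le_trans _ _ ((1 + `|b|) ^+ i)).
    by rewrite lerXn2r ?nnegrE ?addr_ge0 // lerDr.
  by rewrite ler_weXn2l // -ltnS.
rewrite -(ler_pM2r (exprn_gt0 n L0)) => /(le_trans bn).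
rewrite mulrAC invfM [n.+1%:R * _]mulrA divfK ?expf_neq0 ?gt_eqF //.
by rewrite ler_pMl // ler_pdivlMr ?ltr0n // mul1r ler_nat ltnn.
Qed.

(** * Coefficientwise limits of polynomials *)

Section coef_convergence.
Context (K : numFieldType) (T : Type) (F : set_system T) {FF : Filter F}.

(** Each coefficient of a sum or product involves finitely many coefficients of the operands, so
    such limits pass through ring operations without a topology on [{poly K}]. *)
Definition coef_cvg (f : T -> {poly K}) (p : {poly K}) :=
  forall i, ((f t)`_i @[t --> F] --> p`_i)%classic.

Lemma coef_cvg_cst p : coef_cvg (fun=> p) p.
Proof. by move=> i; exact: cvg_cst. Qed.

Lemma cvg_bigsum (I : Type) (r : seq I) (P : pred I) (f : I -> T -> K)
    (l : I -> K) : (forall i, P i -> (f i t @[t --> F] --> l i)%classic) ->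
  (\sum_(i <- r | P i) f i t @[t --> F] --> \sum_(i <- r | P i) l i)%classic.
Proof.
move=> fl; elim: r => [|i r IH].
  by rewrite big_nil; under eq_fun do rewrite big_nil; exact: cvg_cst.
rewrite big_cons; under eq_fun do rewrite big_cons.
by case: ifPn => // Pi; apply: cvgD => //; exact: fl.
Qed.

Lemma coef_cvg_sum (I : Type) (r : seq I) (f : I -> T -> {poly K})
    (p : I -> {poly K}) : (forall i, coef_cvg (f i) (p i)) ->
  coef_cvg (fun t => \sum_(i <- r) f i t) (\sum_(i <- r) p i).
Proof.
move=> fp k; rewrite coef_sum; under eq_fun do rewrite coef_sum.
by apply: cvg_bigsum => i _; exact: fp.
Qed.

Lemma coef_cvgD f g p q : coef_cvg f p -> coef_cvg g q ->
  coef_cvg (fun t => f t + g t) (p + q).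
Proof.
move=> fp gq k; rewrite coefD; under eq_fun do rewrite coefD.
by apply: cvgD; [exact: fp|exact: gq].
Qed.

Lemma coef_cvgN f p : coef_cvg f p -> coef_cvg (fun t => - f t) (- p).
Proof.
move=> fp k; rewrite coefN; under eq_fun do rewrite coefN.
by apply: cvgN; exact: fp.
Qed.

Lemma coef_cvgC f (a : K) : (f t @[t --> F] --> a)%classic ->
  coef_cvg (fun t => (f t)%:P) a%:P.
Proof.
move=> fa k; rewrite coefC; under eq_fun do rewrite coefC.
by case: eqP => // _; exact: cvg_cst.
Qed.

Lemma coef_cvgM f g p q : coef_cvg f p -> coef_cvg g q ->
  coef_cvg (fun t => f t * g t) (p * q).
Proof.
move=> fp gq k; rewrite coefM; under eq_fun do rewrite coefM.
by apply: cvg_bigsum => i _; apply: cvgM; [exact: fp|exact: gq].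
Qed.

Lemma coef_cvg_prod (I : Type) (r : seq I) (f : I -> T -> {poly K})
    (p : I -> {poly K}) : (forall i, coef_cvg (f i) (p i)) ->
  coef_cvg (fun t => \prod_(i <- r) f i t) (\prod_(i <- r) p i).
Proof.
move=> fp; elim: r => [|i r IH].
  by rewrite big_nil; under eq_fun do rewrite big_nil; exact: coef_cvg_cst.
rewrite big_cons; under eq_fun do rewrite big_cons.
exact: coef_cvgM.
Qed.

(** By the Leibniz formula, [char_poly] is a finite sum, over permutations [s], of products of
    entries of the characteristic matrix. *)
Lemma coef_cvg_char_poly n (x : T -> 'M[K]_n) (A : 'M[K]_n) :
  (forall i j, (x t i j @[t --> F] --> A i j)%classic) ->
  coef_cvg (fun t => char_poly (x t)) (char_poly A).
Proof.
move=> xA; apply: coef_cvg_sum => s; apply: coef_cvgM.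
  exact: coef_cvg_cst.
apply: coef_cvg_prod => i; rewrite !mxE; under eq_fun do rewrite !mxE.
by apply: coef_cvgD; [exact: coef_cvg_cst|exact/coef_cvgN/coef_cvgC].
Qed.

End coef_convergence.

Lemma near_root (K : numClosedFieldType) (T : Type) (F : set_system T)
    {FF : Filter F} (n : nat) (x : T -> 'M[K]_n) (A : 'M[K]_n) (eta : K) :
  (forall i j, (x t i j @[t --> F] --> A i j)%classic) -> 0 < eta ->
  \forall t \near F, forall b, root (char_poly (x t)) b ->
    exists2 a, root (char_poly A) a & `|b - a| < eta.
Proof.
move=> xA eta0.
have [d d0 near_d] := root_near (char_poly_monic A) eta0.
have cvgx : coef_cvg F (fun t => char_poly (x t)) (char_poly A).
  exact: coef_cvg_char_poly.
(* Only the coefficients below [n.+1] can be nonzero, so a finite intersection of sets of [F]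
   suffices. *)
have : \forall t \near F, forall i : 'I_n.+1,
    `|(char_poly A)`_i - (char_poly (x t))`_i| < d.
  by apply: filter_forall => i; have /cvgrPdist_lt := cvgx i; exact.
apply: filterS => t xt b; apply: near_d; first by rewrite !size_char_poly.
move=> i; have [ni|ni] := ltnP i n.+1; first exact: (xt (Ordinal ni)).
by rewrite !nth_default ?size_char_poly // subrr normr0.
Qed.

(** * Ultrafilter limits near a finite set *)

Lemma ultra_cvg_near_seq (K : numFieldType) (T : Type) (U : set_system T)
    (f : T -> K) (s : seq K) : UltraFilter U ->
  (forall eta : K, 0 < eta ->
    \forall t \near U, exists2 a, a \in s & `|f t - a| < eta) ->
  exists a : K, (f t @[t --> U] --> a)%classic.
Proof.
move=> UU; elim: s => [|a s IH] near_s.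
  by have [t []] := filter_ex (near_s 1 ltr01).
have [fa|] := pselect (f t @[t --> U] --> a)%classic; first by exists a.
move=> /cvgrPdist_lt/existsNP[e /not_implyP[e0 far]].
have {}far : \forall t \near U, e <= `|f t - a|.
  have [//|] := in_ultra_setVsetC [set t | `|a - f t| < e]%classic UU.
  apply: filterS => t /= /negP; rewrite distrC.
  by rewrite real_leNgt ?(gtr0_real e0) ?normr_real.
apply: IH => eta eta0.
have [d [d0 de deta]] : exists d : K, [/\ 0 < d, d <= e & d <= eta].
  have [ee|ee] := real_leP (gtr0_real e0) (gtr0_real eta0).
    by exists e; rewrite e0 lexx.
  by exists eta; rewrite eta0 lexx ltW.
near=> t.
have [] : exists2 x, x \in a :: s & `|f t - x| < d by near: t; exact: near_s.
move=> x; rewrite inE => /predU1P[-> fad|xs fxd].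
  suff : d < d by rewrite ltxx.
  by apply: le_lt_trans fad; rewrite (le_trans de)//; near: t.
by exists x => //; exact: lt_le_trans fxd deta.
Unshelve. all: by end_near. Qed.

(** * Separated discs in the complex plane *)

(** Positive elements of [R[i]] are real; this brings the tolerances of the [R[i]]-valued norm back
    to [R]. *)
Lemma gt0_real_complex (R : rcfType) (e : R[i]) : 0 < e ->
  exists2 r : R, 0 < r & e = r%:C.
Proof.
move=> e0; exists (Normc.normc e); last by rewrite -[LHS]gtr0_norm.
by rewrite -ltcR -[ltRHS]/(`|e|) normr_gt0 gt_eqF.
Qed.

(** There are finitely many pairs of entries; the [\near] form combines with other smallness
    conditions on [e]. *)
Lemma seq_separated (R : realType) (s : seq R[i]) :
  \forall e \near (0 : R)^'+%classic,
    {in s &, forall a b, a != b -> (2 * e)%:C <= `|a - b|}.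
Proof.
have : \forall e \near (0 : R)^'+%classic, forall i j : 'I_(size s),
    s`_i != s`_j -> (2 * e)%:C <= `|s`_i - s`_j|.
  apply: filter_forall => i; apply: filter_forall => j.
  have [->|neq] := eqVneq s`_i s`_j; first by apply: nearW.
  have [|r r0 ->] := @gt0_real_complex _ `|s`_i - s`_j|.
    by rewrite normr_gt0 subr_eq0.
  have r20 : 0 < r / 2 by rewrite divr_gt0.
  apply: filterS (nbhs_right_lt r20) => e e2 _.
  by rewrite lecR mulrC -ler_pdivlMr // ltW.
apply: filterS => e sep a b /(nthP 0)[i si <-] /(nthP 0)[j sj <-].
exact: (sep (Ordinal si) (Ordinal sj)).
Qed.

(** The intermediate value theorem needs a modulus with values in [R]; continuity is the reverse
    triangle inequality. *)
Lemma normc_continuous (R : realType) :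
  continuous (@Normc.normc R : R[i] -> R).
Proof.
move=> x; apply/(@cvgrPdist_lt _ _ _ _ (nbhs_filter (x : R[i]))) => e e0.
have e0' : 0 < e%:C by rewrite ltcR.
have : \forall y \near x, `|x - y| < e%:C by exists e%:C.
apply: filterS => y.
rewrite -[X in X < _]/((Normc.normc (x - y))%:C) ltcR; apply: le_lt_trans.
have ler_sub (a b : R[i]) :
    Normc.normc a - Normc.normc b <= Normc.normc (a - b).
  by rewrite lerBlDr -{1}(subrK b a); exact: le_normcD.
rewrite ler_norml ler_sub andbT lerNl opprB (le_trans (ler_sub _ _)) //.
by rewrite -opprB; rewrite normcN.
Qed.

(* The distance to the root next to [f u] cannot cross the value [eta] without
   taking it, and there no root is within [eta]. *)
Lemma path_trapped (R : realType) (f : R -> R[i]) (s : seq R[i]) (eta u v : R) :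
  u <= v -> {within `[u, v], continuous f}%classic ->
  {in s &, forall a b, a != b -> (2 * eta)%:C <= `|a - b|} ->
  (forall w, w \in `[u, v] -> exists2 a, a \in s & `|f w - a| < eta%:C) ->
  `|f u - f v| < (2 * eta)%:C.
Proof.
move=> uv fcont sep near_s; pose g a w := Normc.normc (f w - a).
have gE a w : `|f w - a| = (g a w)%:C by [].
have gcont a : {within `[u, v], continuous (g a)}%classic.
  apply/subspace_continuousP => w wuv.
  apply: (@cvg_comp _ _ _ (fun w => f w - a) (@Normc.normc R) _
    (nbhs (f w - a))); last exact: normc_continuous.
  apply: cvgB; last exact: cvg_cst.
  by move/subspace_continuousP : fcont; exact.
have [|a sa] := near_s u; first by rewrite in_itv /= lexx.
rewrite gE ltcR => gu.
have gv : g a v < eta.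
  rewrite ltNge; apply/negP => gv.
  have [|w wuv gw] := @IVT _ _ _ _ eta uv (gcont a).
    by rewrite ge_min (ltW gu) le_max gv orbT.
  (* At [w] the root [a] is at distance exactly [eta], and another root [b] within [eta] of [f w]
     would be less than [2 * eta] from [a], against [sep]. *)
  have [b sb] := near_s w wuv.
  have [->|ab] := eqVneq b a; first by rewrite gE gw ltxx.
  rewrite distrC => fb; suff : (2 * eta)%:C < (2 * eta)%:C by rewrite ltxx.
  apply: le_lt_trans (sep _ _ sb sa ab) _.
  apply: le_lt_trans (ler_distD (f w) _ _) _.
  by rewrite mulr_natl mulr2n rmorphD /= gE gw ltrD2r.
apply: le_lt_trans (ler_distD a _ _) _.
by rewrite (distrC a) !gE mulr_natl mulr2n -rmorphD ltcR ltrD.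
Qed.

(** * Spectra and characteristic polynomials *)

(** A product of linear factors determines its roots with multiplicity. Multisets are thus traded
    for polynomials, where limits can be taken. *)
Lemma spectrum_seqP (R : realType) (n : nat) (A : 'M[R[i]]_n) (s : seq R[i]) :
  spectrum A = seq_mset s <-> char_poly A = \prod_(z <- s) ('X - z%:P).
Proof.
rewrite /spectrum; case: closed_field_poly_normal => t /= Dt.
rewrite (monicP (char_poly_monic A)) scale1r in Dt; rewrite Dt; split.
  by move/eq_seq_msetP; exact: perm_big.
move=> eqp; apply/eq_seq_msetP/allP => /= z _.
by rewrite /= -!mu_prod_XsubC eqp.
Qed.

Lemma eigenpath_char_poly (R : realType) (n : nat) (C : R -> 'M[R[i]]_n)
    (gamma : 'I_n -> R -> R[i]) (a : R) :
  spectrum (C a) = seq_mset [seq gamma j a | j <- enum 'I_n] <->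
  char_poly (C a) = \prod_(j < n) ('X - (gamma j a)%:P).
Proof.
by rewrite spectrum_seqP big_map big_enum.
Qed.

Lemma eigenpath_root (R : realType) (n : nat) (C : R -> 'M[R[i]]_n)
    (gamma : 'I_n -> R -> R[i]) (a : R) (j : 'I_n) :
  eigenpath_set C gamma -> a \in `[0, 1] -> root (char_poly (C a)) (gamma j a).
Proof.
move=> [_ gammaC] a01; rewrite ((eigenpath_char_poly _ _ _).1 (gammaC a a01)).
by rewrite rootE horner_prod (bigD1 j) //= hornerXsubC subrr mul0r.
Qed.

(** * Limits of eigenpath sets *)

Section eigenpath_limit.
Context (R : realType) (n : nat) (C : R -> 'M[R[i]]_n) (pathC : matrix_path C).
Context (Ck : nat -> R -> 'M[R[i]]_n) (gk : nat -> 'I_n -> R -> R[i]).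
Hypothesis CkC : forall k a, a \in `[0, 1] ->
  `|C a - Ck k a| < (k.+1%:R^-1)%:C.
Hypothesis gkC : forall k, eigenpath_set (Ck k) (gk k).

(** [Ck k s] tends to [C a] jointly as [s] tends to [a] in [[0, 1]] and [k] to infinity; a rectangle
    in the product filter gives a radius [r] independent of [k]. *)
Lemma near_eigenpath_root (a : R) (eta : R[i]) : a \in `[0, 1] -> 0 < eta ->
  exists2 r : R, 0 < r & \forall k \near \oo%classic, forall s j,
    s \in `[0, 1] -> `|s - a| < r ->
    exists2 z, root (char_poly (C a)) z & `|gk k j s - z| < eta.
Proof.
move=> a01 eta0.
pose F := filter_prod (within `[0, 1]%classic (nbhs a)) \oo%classic.
have F01 : \forall sk \near F, sk.1 \in `[0, 1].
  exists (`[0, 1]%classic, setT) => /=; last by move=> [s k] [].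
  by split; [exact: withinT|exact: filterT].
have CkF : (Ck sk.2 sk.1 @[sk --> F] --> C a)%classic.
  apply/cvgrPdist_lt => e e0.
  have e20 : 0 < e / 2 by rewrite divr_gt0.
  have [r r0 e2E] := gt0_real_complex e20.
  have Ca : \forall s \near within `[0, 1]%classic (nbhs a),
      `|C a - C s| < e / 2.
    have /subspace_continuousP /(_ a a01) /cvgrPdist_lt := pathC; exact.
  have k2 : \forall k \near \oo%classic, (k.+1%:R^-1)%:C < e / 2.
    rewrite e2E; apply: filterS (near_infty_natSinv_lt (PosNum r0)) => k.
    by rewrite ltcR.
  near=> sk; apply: le_lt_trans (ler_distD (C sk.1) _ _) _.
  have -> : e = e / 2 + e / 2 by field.
  rewrite ltrD //.
    near: sk; exists ([set s | `|C a - C s| < e / 2]%classic, setT) => /=.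
      by split => //; exact: filterT.
    by move=> [s k] [].
  apply: (@lt_trans _ _ (sk.2.+1%:R^-1)%:C).
    by apply: CkC; near: sk.
  near: sk; exists (setT, [set k | (k.+1%:R^-1)%:C < e / 2]%classic) => /=.
    by split => //; exact: filterT.
  by move=> [s k] [].
have := near_root (x := fun sk => Ck sk.2 sk.1) (A := C a) (F := F) _ eta0.
case.
  move=> i j; apply: (cvg_comp _ _ CkF (@coord_continuous _ _ _ i j (C a))).
move=> [P Q] /= [] Pa Qoo PQ.
have [r r0 rP] : exists2 r : R, 0 < r &
    forall s, s \in `[0, 1] -> `|s - a| < r -> P s.
  move/nbhs_ballP : Pa => [r /= r0 rP]; exists r => // s s01 sa.
  by apply: rP => //; rewrite /ball /= distrC.
exists r => //; apply: filterS Qoo => k Qk s j s01 sa.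
apply: (PQ (s, k)); first by split => //; exact: rP.
exact: eigenpath_root.
Unshelve. all: by end_near. Qed.

(** The discs of radius [e] around the eigenvalues of [C a] are disjoint, so each path is trapped in
    one of them and moves by less than [2 * e < eta]. *)
Lemma near_eigenpath_equicontinuous (a eta : R) : a \in `[0, 1] -> 0 < eta ->
  exists2 r : R, 0 < r & \forall k \near \oo%classic, forall s j,
    s \in `[0, 1] -> `|s - a| < r -> `|gk k j a - gk k j s| < eta%:C.
Proof.
move=> a01 eta0; have [S DS] := closed_field_poly_normal (char_poly (C a)).
rewrite (monicP (char_poly_monic _)) scale1r in DS.
have [e [e0 e_eta sep]] : exists e : R, [/\ 0 < e, 2 * e < eta &
    {in S &, forall x y, x != y -> (2 * e)%:C <= `|x - y|}].
  apply: (@filter_ex _ (0 : R)^'+%classic).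
  near=> e; split.
  - by near: e; exact: nbhs_right_gt.
  - rewrite mulrC -ltr_pdivlMr //; near: e; apply: nbhs_right_lt.
    by rewrite divr_gt0.
  - by near: e; exact: seq_separated.
have e0' : 0 < e%:C by rewrite ltcR.
have [r r0 near_r] := near_eigenpath_root a01 e0'.
exists r => //; apply: filterS near_r => k near_r s j s01 sa.
(* Trapping works on ordered segments, while [s] may lie on either side of [a]. *)
have trap u v : u \in `[0, 1] -> v \in `[0, 1] -> `|u - a| < r ->
    `|v - a| < r -> u <= v -> `|gk k j u - gk k j v| < eta%:C.
  move=> u01 v01 ua va uv.
  apply: (@lt_trans _ _ (2 * e)%:C); last by rewrite ltcR.
  apply: (path_trapped uv _ sep) => [|w wuv].
    apply: continuous_subspaceW ((gkC k).1 j) => w /=.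
    move: u01 v01; rewrite !in_itv /= => /andP[u0 _] /andP[_ v1] /andP[uw wv].
    by rewrite (le_trans u0) //= (le_trans wv).
  have [||z] := near_r w j.
  - move: u01 v01 wuv.
    rewrite !in_itv /= => /andP[u0 _] /andP[_ v1] /andP[uw wv].
    by rewrite (le_trans u0) //= (le_trans wv).
  - move: ua va wuv; rewrite in_itv /= !ltr_norml.
    move=> /andP[ua _] /andP[_ va] /andP[uw wv].
    by rewrite (lt_le_trans ua) ?lerB //= (le_lt_trans _ va) ?lerB.
  by rewrite DS root_prod_XsubC; exists z.
have aa : `|a - a| < r by rewrite subrr normr0.
have [as_|sa_] := leP a s; first exact: trap.
by rewrite distrC; apply: trap => //; exact: ltW.
Unshelve. all: by end_near. Qed.

(** Arzela-Ascoli along [U]: one ultrafilter gives the limits at all [a] and [j] at once, with no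
    extraction of subsequences. *)
Lemma eigenpath_limit (U : set_system nat) : UltraFilter U ->
  (\oo `<=` U)%classic ->
  exists2 gamma : 'I_n -> R -> R[i], eigenpath_set C gamma &
    forall eta : R, 0 < eta -> \forall k \near U, forall s j, s \in `[0, 1] ->
      `|gamma j s - gk k j s| < eta%:C.
Proof.
move=> UU ooU.
(* Pairing [j] and [a] allows a single use of [choice]; outside [[0, 1]] the value is arbitrary. *)
have lim_ex (ja : 'I_n * R) : exists z : R[i],
    ja.2 \in `[0, 1] -> (gk k ja.1 ja.2 @[k --> U] --> z)%classic.
  case: ja => j a /=; have [a01|] := boolP (a \in `[0, 1]); last by exists 0.
  have [S DS] := closed_field_poly_normal (char_poly (C a)).
  rewrite (monicP (char_poly_monic _)) scale1r in DS.
  have [eta eta0|z zlim] := @ultra_cvg_near_seq _ _ U (fun k => gk k j a) S UU.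
    have [r r0 near_r] := near_eigenpath_root a01 eta0.
    apply: ooU; apply: filterS near_r => k /(_ a j a01).
    by rewrite subrr normr0 DS => /(_ r0)[z]; rewrite root_prod_XsubC; exists z.
  by exists z.
have [g glim] := choice lim_ex; pose gamma j a := g (j, a).
have {}glim j a : a \in `[0, 1] -> (gk k j a @[k --> U] --> gamma j a)%classic.
  exact: (glim (j, a)).
have near_lim j a (e : R) : a \in `[0, 1] -> 0 < e ->
    \forall k \near U, `|gamma j a - gk k j a| < e%:C.
  move=> a01 e0; have /cvgrPdist_lt := glim j a a01.
  by apply; rewrite ltcR.
have third (eta : R) : eta%:C = (eta / 3)%:C + ((eta / 3)%:C + (eta / 3)%:C).
  by rewrite -!rmorphD; congr _%:C; field.
have gamma_equi a (eta : R) : a \in `[0, 1] -> 0 < eta ->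
    exists2 r : R, 0 < r & forall s j, s \in `[0, 1] -> `|s - a| < r ->
      `|gamma j a - gamma j s| < eta%:C.
  move=> a01 eta0; have eta30 : 0 < eta / 3 by rewrite divr_gt0.
  have [r r0 near_r] := near_eigenpath_equicontinuous a01 eta30.
  exists r => // s j s01 sa.
  (* This [k] may depend on [s], but [r] does not, so pointwise limits suffice. *)
  have [k [ka ks kas]] : exists k, [/\ `|gamma j a - gk k j a| < (eta / 3)%:C,
      `|gamma j s - gk k j s| < (eta / 3)%:C &
      `|gk k j a - gk k j s| < (eta / 3)%:C].
    apply: (@filter_ex _ U).
    near=> k; split.
    - by near: k; exact: near_lim.
    - by near: k; exact: near_lim.
    - by near: k; apply: ooU; apply: filterS near_r => k; exact.
  apply: le_lt_trans (ler_distD (gk k j a) _ _) _.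
  apply: le_lt_trans (lerD (lexx _) (ler_distD (gk k j s) _ _)) _.
  by rewrite third !ltrD // distrC.
exists gamma.
  split => [j|a a01].
    apply/subspace_continuousP => a a01.
    apply/cvgrPdist_lt => _ /gt0_real_complex[e e0 ->].
    have [r r0 near_r] := gamma_equi a _ a01 e0.
    apply/nbhs_ballP; exists r => //= s; rewrite /ball /= distrC => sa s01.
    exact: near_r.
  apply/eigenpath_char_poly/polyP => i.
  (* The coefficient has two limits along [U]: one from the entries of [Ck k a], one from its
     factorisation over ['I_n], which preserves multiplicities. *)
  apply: (@cvg_unique _ (@norm_hausdorff _ R[i])
    ((char_poly (Ck k a))`_i @[k --> U])%classic).
  - apply: coef_cvg_char_poly => i1 i2.
    have CkU : (Ck k a @[k --> U] --> C a)%classic.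
      apply/cvgrPdist_lt => _ /gt0_real_complex[e e0 ->].
      apply: ooU; apply: filterS (near_infty_natSinv_lt (PosNum e0)) => k.
      rewrite -ltcR /=; apply: lt_trans; exact: CkC.
    exact: (cvg_comp _ _ CkU (@coord_continuous _ _ _ i1 i2 (C a))).
  - have -> : (fun k => (char_poly (Ck k a))`_i) =
        (fun k => (\prod_(j < n) ('X - (gk k j a)%:P))`_i).
      apply: funext => k.
      by rewrite ((eigenpath_char_poly _ _ _).1 ((gkC k).2 a a01)).
    apply: coef_cvg_prod => j; apply: coef_cvgD; first exact: coef_cvg_cst.
    apply: coef_cvgN; apply: coef_cvgC; exact: glim.
move=> eta eta0.
(* In its near-covering form, compactness turns bounds valid around each [a] for [U]-almost all [k]
   into one valid on all of [[0, 1]]. *)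
have /compact_near_coveringP cov := @segment_compact R 0 1.
pose P k s := s \in `[0, 1] -> forall j, `|gamma j s - gk k j s| < eta%:C.
have : \forall k \near U, (`[0, 1] `<=` P k)%classic.
  apply: cov => a a01; have eta30 : 0 < eta / 3 by rewrite divr_gt0.
  have [r r0 near_r] := near_eigenpath_equicontinuous a01 eta30.
  have [r' r'0 near_r'] := gamma_equi a _ a01 eta30.
  have near_a : \forall k \near U, forall j,
      `|gamma j a - gk k j a| < (eta / 3)%:C.
    by apply: filter_forall => j; exact: near_lim.
  pose Q k := (forall s j, s \in `[0, 1] -> `|s - a| < r ->
    `|gk k j a - gk k j s| < (eta / 3)%:C) /\
    (forall j, `|gamma j a - gk k j a| < (eta / 3)%:C).
  (* Convergence is used at the centre [a] only; equicontinuity of [gk] (radius [r]) and continuity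
     of [gamma] (radius [r']) carry it to [s]. *)
  exists (ball a (Num.min r r'), Q) => /=.
    split; first by apply: nbhsx_ballx; rewrite lt_min r0.
    exact: (@filterI _ U _ _ _ (ooU _ near_r) near_a).
  move=> [s k] [/=]; rewrite /ball /= distrC lt_min => /andP[sr sr'] [ks ka].
  move=> s01 j; apply: le_lt_trans (ler_distD (gamma j a) _ _) _.
  apply: le_lt_trans (lerD (lexx _) (ler_distD (gk k j a) _ _)) _.
  rewrite third; apply: ltrD; first by rewrite distrC near_r'.
  by apply: ltrD => //; exact: ks.
by apply: filterS => k Pk s j s01; exact: Pk.
Unshelve. all: by end_near. Qed.

End eigenpath_limit.

(** * Existence of [delta] by contradiction *)

Theorem theorem1 (R : realType) (n : nat) (eps : R) (eps_gt0 : 0 < eps)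
    (C : R -> 'M[R[i]]_n) (pathC : matrix_path C) :
  exists2 delta : R, 0 < delta &
    forall C' : R -> 'M[R[i]]_n, matrix_path C' ->
    (forall a : R, a \in `[0, 1] -> `|C a - C' a| < delta%:C) ->
    forall gamma' : 'I_n -> R -> R[i], eigenpath_set C' gamma' ->
    exists2 gamma : 'I_n -> R -> R[i], eigenpath_set C gamma &
      forall (a : R) (j : 'I_n), a \in `[0, 1] ->
        `|gamma j a - gamma' j a| < eps%:C.
Proof.
apply: contrapT => no_delta.
have bad (k : nat) : exists Cg : (R -> 'M[R[i]]_n) * ('I_n -> R -> R[i]),
    [/\ forall a, a \in `[0, 1] -> `|C a - Cg.1 a| < (k.+1%:R^-1)%:C,
        eigenpath_set Cg.1 Cg.2 &
        forall gamma, eigenpath_set C gamma -> ~ forall (a : R) (j : 'I_n),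
          a \in `[0, 1] -> `|gamma j a - Cg.2 j a| < eps%:C].
  apply: contrapT => no_bad; apply: no_delta.
  exists k.+1%:R^-1 => [|C' _ CC' gamma' eC']; first by rewrite invr_gt0.
  apply: contrapT => no_gamma; apply: no_bad; exists (C', gamma'); split => //.
  by move=> gamma eC close; apply: no_gamma; exists gamma.
have [Cg Cg_bad] := choice bad.
(* Refining [\oo] makes [U] contain every tail, so it is nonprincipal. *)
have [U [UU ooU]] := ultraFilterLemma (F := \oo%classic) _.
have CgC k a : a \in `[0, 1] -> `|C a - (Cg k).1 a| < (k.+1%:R^-1)%:C.
  by have [+ _ _] := Cg_bad k; exact.
have gC k : eigenpath_set (Cg k).1 (Cg k).2 by have [] := Cg_bad k.
have [gamma eC near_gamma] := eigenpath_limit pathC CgC gC UU ooU.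
(* Sets of [U] are nonempty, so a single [k] is already uniformly [eps]-close to [gamma], which
   [Cg_bad k] excludes. *)
have [k close] := filter_ex (near_gamma _ eps_gt0).
have [_ _] := Cg_bad k; apply; first exact: eC.
by move=> a j a01; exact: close.
Qed.
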